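(* Let $\alpha,\beta\ge -1$ be fixed. Let $\mathcal{G}$ be the set of growth functions and define $$\mathcal{F}=\left\{(\Phi,\Psi)\in\mathcal{G}^2\;\middle|\;\exists\, C>0\text{ such that }\Phi^{-1}(t^{2+\alpha})\le C\,\Psi^{-1}(t^{2+\beta})\text{ for all }t>0\right\}.$$ Then $\mathcal{F}$ is inverse log-convex, that is: if $(\Phi_0,\Psi_0),(\Phi_1,\Psi_1)\in\mathcal{F}$, then for every $\theta\in(0,1)$ the pair $(\Phi_\theta,\Psi_\theta)$ defined by $$\Phi_\theta^{-1}(t)=\Phi_0^{-1}(t)^{1-\theta}\,\Phi_1^{-1}(t)^{\theta},\qquad \Psi_\theta^{-1}(t)=\Psi_0^{-1}(t)^{1-\theta}\,\Psi_1^{-1}(t)^{\theta}$$ also belongs to $\mathcal{F}$.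
   Context: A growth function is an increasing function $\Phi:[0,\infty)\to[0,\infty)$ with $\Phi(0)=0$ and $\Phi(t)\to\infty$ as $t\to\infty$. The growth functions whose inverse is used are assumed to be bijections of $[0,\infty)$, i.e. strictly increasing and continuous. $\Phi_\theta$ (resp. $\Psi_\theta$) denotes the growth function whose inverse is the function given by the displayed formula. *)

(* Defs.v *)
From mathcomp Require Import all_boot all_order all_algebra.
From mathcomp Require Import all_classical all_reals all_analysis.

Set Implicit Arguments.
Unset Strict Implicit.
Unset Printing Implicit Defensive.

Import Order.TTheory GRing.Theory Num.Theory.
Import numFieldNormedType.Exports.

Local Open Scope classical_set_scope.
Local Open Scope ring_scope.

(* A function [0, +oo) -> [0, +oo) is represented by a total function R -> R of
   which only the restriction to [0, +oo) matters. *)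
Definition nonnegs (R : realType) : set R := `[0, +oo[%classic.
Arguments nonnegs : clear implicits.

(* "Increasing" is meant in the wide sense here; strictness (and continuity)
   follow from bijectivity wherever an inverse is taken. *)
Definition growth_function (R : realType) (Phi : R -> R) : Prop :=
  [/\ set_fun (nonnegs R) (nonnegs R) Phi,
      {in nonnegs R &, {homo Phi : s t / s <= t}},
      Phi 0 = 0 &
      Phi t @[t --> +oo] --> +oo].

Definition invertible_growth (R : realType) (Phi : R -> R) : Prop :=
  growth_function Phi /\ set_bij (nonnegs R) (nonnegs R) Phi.

(* Phi^-1 : [0, +oo) -> [0, +oo), extended by the arbitrary value 0 outside
   the image of [0, +oo). *)
Definition ginv (R : realType) (Phi : R -> R) : R -> R :=
  'pinv_(fun=> 0) (nonnegs R) Phi.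

Definition growth_pairs (R : realType) (alpha beta : R) :
    set ((R -> R) * (R -> R)) :=
  [set P | [/\ invertible_growth P.1, invertible_growth P.2 &
    exists2 C : R, 0 < C &
      forall t : R, 0 < t ->
        ginv P.1 (t `^ (2 + alpha)) <= C * ginv P.2 (t `^ (2 + beta))]].

(* Phi is the growth function Phi_theta, characterised by its inverse
   Phi0^-1 (t) ^ (1 - theta) * Phi1^-1 (t) ^ theta. *)
Definition is_inverse_interpolant (R : realType) (theta : R)
    (Phi0 Phi1 Phi : R -> R) : Prop :=
  invertible_growth Phi /\
  forall t : R, 0 <= t ->
    ginv Phi t = ginv Phi0 t `^ (1 - theta) * ginv Phi1 t `^ theta.

(* The interpolants are determined only on [0, +oo), so "the pair
   (Phi_theta, Psi_theta) belongs to F" is rendered as: interpolants exist, and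
   every choice of them gives a pair in F. *)
Definition inverse_log_convex (R : realType)
    (F : set ((R -> R) * (R -> R))) : Prop :=
  forall Phi0 Psi0 Phi1 Psi1 : R -> R,
    F (Phi0, Psi0) -> F (Phi1, Psi1) ->
  forall theta : R, 0 < theta < 1 ->
    [/\ exists Phi, is_inverse_interpolant theta Phi0 Phi1 Phi,
        exists Psi, is_inverse_interpolant theta Psi0 Psi1 Psi &
        forall Phi Psi : R -> R,
          is_inverse_interpolant theta Phi0 Phi1 Phi ->
          is_inverse_interpolant theta Psi0 Psi1 Psi ->
          F (Phi, Psi)].

(* Main.v *)
Require Import Defs.
From mathcomp Require Import all_boot all_order all_algebra.
From mathcomp Require Import all_classical all_reals all_analysis.
Import Order.TTheory GRing.Theory Num.Theory.
Import numFieldNormedType.Exports.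

Local Open Scope ring_scope.

(** The invertible growth functions are exactly the order automorphisms of
    [0, +oo): a nondecreasing bijection of the half-line automatically fixes 0
    and tends to +oo (lemma [invertible_growthP]).  In this form they are
    visibly closed under composition and inversion, and every power map
    x |-> x ^ p with p > 0 is one of them.  They are also closed under
    pointwise product: a product of two of them is strictly increasing and
    unbounded, and it is continuous because a monotone surjection has no jumps,
    so the intermediate value theorem makes it onto ([invertible_growthM]).

    Consequently f ^ (1 - theta) * g ^ theta is an invertible growth function
    whenever f and g are; with f and g the inverses of the two given growth
    functions, the inverse of this mean is the required interpolant.

    Membership of the interpolated pair is then pure multiplicativity.  Raising
    f0 <= C0 * g0 to the power 1 - theta and f1 <= C1 * g1 to the power theta,
    and multiplying, bounds the interpolated left-hand side with constant
    C0 ^ (1 - theta) * C1 ^ theta, at the same argument t ([wgeo_mean_le]). *)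

Section InvertibleGrowth.
Set Implicit Arguments.
Unset Strict Implicit.
Context {R : realType}.
Implicit Types (f g : R -> R) (x y b p : R).

Lemma nonnegsE x : nonnegs R x = (0 <= x).
Proof. by rewrite /nonnegs /= in_itv /= andbT. Qed.

Lemma mem_nonnegs x : (x \in nonnegs R) = (0 <= x).
Proof. by apply/idP/idP; rewrite inE nonnegsE. Qed.

(** The value at 0 is at most the value at a preimage of 0, and a preimage of A
    is a threshold beyond which f is at least A; so the last two clauses in the
    definition of a growth function come for free. *)
Lemma invertible_growthP f : set_bij (nonnegs R) (nonnegs R) f ->
  {in nonnegs R &, {homo f : x y / x <= y}} -> invertible_growth f.
Proof.
move=> fbij fle; have [fN _ fsurj] := fbij; split=> //; split=> //.
- have [x xN fx0] : exists2 x, nonnegs R x & f x = 0.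
    by apply: fsurj; rewrite nonnegsE.
  apply/eqP; rewrite eq_le; apply/andP; split.
    rewrite nonnegsE in xN.
    by rewrite -{2}fx0; apply: fle; rewrite ?mem_nonnegs.
  by rewrite -nonnegsE; apply: fN; rewrite nonnegsE.
- apply/cvgryPge => A.
  have [x xN fxA] : exists2 x, nonnegs R x & f x = Num.max A 0.
    by apply: fsurj; rewrite nonnegsE le_max lexx orbT.
  rewrite nonnegsE in xN.
  near=> t.
  have xt : x <= t by near: t; apply: nbhs_pinfty_ge; rewrite num_real.
  have Afx : A <= f x by rewrite fxA le_max lexx.
  apply: (le_trans Afx); apply: fle => //; rewrite mem_nonnegs ?(le_trans xN xt).
Unshelve. all: by end_near. Qed.

Section Projections.
Variables (f : R -> R) (fig : invertible_growth f).

Lemma invertible_growth_ge0 x : 0 <= x -> 0 <= f x.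
Proof. by case: fig => [[fN _ _ _] _]; rewrite -!nonnegsE; apply: fN. Qed.

Lemma invertible_growth_surj y : 0 <= y -> exists2 x, 0 <= x & f x = y.
Proof.
case: fig => _ [_ _ fsurj]; rewrite -nonnegsE => /fsurj[x xN fx].
by exists x; rewrite -?nonnegsE.
Qed.

Lemma invertible_growth_inj x y : 0 <= x -> 0 <= y -> f x = f y -> x = y.
Proof.
by case: fig => _ [_ finj _] x0 y0; apply: finj; rewrite mem_nonnegs.
Qed.

Lemma invertible_growth_homo x y : 0 <= x -> x <= y -> f x <= f y.
Proof.
case: fig => [[_ fle _ _] _] x0 xy.
by apply: fle; rewrite ?mem_nonnegs// (le_trans x0).
Qed.

Lemma invertible_growth_lt x y : 0 <= x -> x < y -> f x < f y.
Proof.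
move=> x0 xy; rewrite lt_neqAle invertible_growth_homo ?(ltW xy)// andbT.
apply/eqP => /(invertible_growth_inj x0 (le_trans x0 (ltW xy))) xyE.
by rewrite xyE ltxx in xy.
Qed.

Lemma invertible_growth_le x y :
  0 <= x -> 0 <= y -> (f x <= f y) = (x <= y).
Proof.
move=> x0 y0; apply/idP/idP; last exact: invertible_growth_homo.
by apply: contraLR; rewrite -!ltNge; apply: invertible_growth_lt.
Qed.

Lemma invertible_growth0 : f 0 = 0.
Proof. by case: fig => [[]]. Qed.

(** A monotone function whose image leaves out no intermediate value cannot
    jump. *)
Lemma invertible_growth_continuous b : 0 <= b ->
  {within `[0, b], continuous f}%classic.
Proof.
move=> b0; apply: segment_inc_surj_continuous.
  move=> x y; rewrite !in_itv /= => /andP[x0 _] /andP[y0 _].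
  exact: invertible_growth_le.
move=> v /=; rewrite in_itv /= invertible_growth0 => /andP[v0 vb].
have [x x0 fx] := invertible_growth_surj v0; exists x => //=.
by rewrite in_itv /= x0 /= -invertible_growth_le// fx.
Qed.

End Projections.

Lemma invertible_growth_comp f g : invertible_growth f ->
  invertible_growth g -> invertible_growth (g \o f).
Proof.
move=> fig gig; apply: invertible_growthP.
  by case: fig gig => [_ fbij] [_ gbij]; exact: set_bij_comp fbij gbij.
move=> x y; rewrite !mem_nonnegs => x0 y0 xy /=.
apply: (invertible_growth_homo gig); first exact: invertible_growth_ge0.
exact: invertible_growth_homo.
Qed.

Lemma ginvK f y : invertible_growth f -> 0 <= y -> f (ginv f y) = y.
Proof.
move=> [_ [_ _ fsurj]] y0; apply: (surjpK _ fsurj).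
by rewrite mem_nonnegs.
Qed.

Lemma invertible_growth_ginv f :
  invertible_growth f -> invertible_growth (ginv f).
Proof.
move=> fig; have [_ fbij] := fig.
have gbij : set_bij (nonnegs R) (nonnegs R) (ginv f) by exact: bijpinv_bij.
have [gN _ _] := gbij.
have g0 y : 0 <= y -> 0 <= ginv f y by rewrite -!nonnegsE => /gN.
apply: invertible_growthP => // x y; rewrite !mem_nonnegs => x0 y0 xy.
by rewrite -(invertible_growth_le fig) ?ginvK// g0.
Qed.

Lemma ginv_involutive f x :
  invertible_growth f -> 0 <= x -> ginv (ginv f) x = f x.
Proof.
move=> fig x0; have gig := invertible_growth_ginv fig.
apply: (invertible_growth_inj gig).
- exact: (invertible_growth_ge0 (invertible_growth_ginv gig)).
- exact: invertible_growth_ge0.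
rewrite ginvK//; have [_ [_ finj _]] := fig.
by rewrite /ginv pinvKV ?mem_nonnegs.
Qed.

Lemma invertible_growth_powR p : 0 < p -> invertible_growth (@powR R ^~ p).
Proof.
move=> p0; apply: invertible_growthP.
  split.
  - by move=> x _; rewrite nonnegsE powR_ge0.
  - move=> x y; rewrite !mem_nonnegs => x0 y0.
    exact: (powR_injective p0).
  - move=> y; rewrite nonnegsE => y0; exists (y `^ p^-1).
      by rewrite nonnegsE powR_ge0.
    by rewrite /= -powRrM mulVf ?gt_eqF// powRr1.
move=> x y; rewrite !mem_nonnegs => x0 y0.
exact: (ge0_ler_powR (ltW p0)).
Qed.

(** Only surjectivity needs an argument: if f reaches y at b1 and g reaches 1
    at b2, then the product is at least y at max b1 b2, and the intermediate
    value theorem applies on [0, max b1 b2]. *)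
Lemma invertible_growthM f g : invertible_growth f -> invertible_growth g ->
  invertible_growth (fun x => f x * g x).
Proof.
move=> fig gig.
have f0 := invertible_growth_ge0 fig; have g0 := invertible_growth_ge0 gig.
have fglt x y : 0 <= x -> x < y -> f x * g x < f y * g y.
  move=> x0 xy.
  by apply: ltr_pM; rewrite ?f0 ?g0 ?invertible_growth_lt.
apply: invertible_growthP; last first.
  move=> x y; rewrite !mem_nonnegs => x0 y0.
  by rewrite le_eqVlt => /predU1P[->//|xy]; rewrite ltW ?fglt.
split.
- by move=> x; rewrite !nonnegsE => x0; rewrite mulr_ge0 ?f0 ?g0.
- move=> x y; rewrite !mem_nonnegs => x0 y0 fgxy.
  by case: (ltgtP x y) => // [/(fglt _ _ x0)|/(fglt _ _ y0)]; rewrite fgxy ltxx.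
- move=> y; rewrite nonnegsE => y0.
  have [b1 b10 fb1] := invertible_growth_surj fig y0.
  have [b2 b20 gb2] := invertible_growth_surj gig (@ler01 R).
  pose b := Num.max b1 b2.
  have b0 : 0 <= b by rewrite le_max b10.
  have fb : y <= f b.
    by rewrite -fb1; apply: (invertible_growth_homo fig); rewrite ?le_max ?lexx.
  have gb : 1 <= g b.
    rewrite -gb2; apply: (invertible_growth_homo gig) => //.
    by rewrite le_max lexx orbT.
  have yb : y <= f b * g b by rewrite (le_trans fb)// ler_peMr// f0.
  have [||c cb fgc] := @IVT R (fun x => f x * g x) 0 b y b0.
  + move=> x; apply: cvgM; [exact: (invertible_growth_continuous fig b0)|].
    exact: (invertible_growth_continuous gig b0).
  + by rewrite (invertible_growth0 fig) mul0r ge_min y0/= le_max yb orbT.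
  by exists c => //; rewrite nonnegsE; move: cb; rewrite in_itv => /andP[].
Qed.

Lemma invertible_growth_wgeo_mean p q f g : 0 < p -> 0 < q ->
  invertible_growth f -> invertible_growth g ->
  invertible_growth (fun x => f x `^ p * g x `^ q).
Proof.
move=> p0 q0 fig gig; apply: invertible_growthM.
  exact: (invertible_growth_comp fig (invertible_growth_powR p0)).
exact: (invertible_growth_comp gig (invertible_growth_powR q0)).
Qed.

Lemma wgeo_mean_le p q (a0 a1 b0 b1 c0 c1 : R) : 0 <= p -> 0 <= q ->
  0 <= a0 -> 0 <= a1 -> 0 <= b0 -> 0 <= b1 -> 0 <= c0 -> 0 <= c1 ->
  a0 <= c0 * b0 -> a1 <= c1 * b1 ->
  a0 `^ p * a1 `^ q <= (c0 `^ p * c1 `^ q) * (b0 `^ p * b1 `^ q).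
Proof.
move=> p0 q0 a00 a10 b00 b10 c00 c10 le0 le1.
rewrite mulrACA -!powRM//.
by apply: ler_pM; rewrite ?powR_ge0//; apply: ge0_ler_powR;
  rewrite ?nnegrE ?mulr_ge0.
Qed.

(** The inverse of an invertible growth function is again one, so the
    interpolant can be defined as the inverse of the weighted geometric mean;
    inverting twice returns the mean itself. *)
Lemma inverse_interpolant_exists theta f g : 0 < theta < 1 ->
  invertible_growth f -> invertible_growth g ->
  exists h, is_inverse_interpolant theta f g h.
Proof.
move=> /andP[theta0 theta1] fig gig.
have mig : invertible_growth
    (fun t => ginv f t `^ (1 - theta) * ginv g t `^ theta).
  by apply: invertible_growth_wgeo_mean; rewrite ?subr_gt0//;
    exact: invertible_growth_ginv.
exists (ginv (fun t => ginv f t `^ (1 - theta) * ginv g t `^ theta)).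
split; first exact: invertible_growth_ginv.
by move=> t t0; rewrite ginv_involutive.
Qed.

End InvertibleGrowth.

Theorem theorem2 (R : realType) (alpha beta : R)
    (halpha : -1 <= alpha) (hbeta : -1 <= beta) :
  inverse_log_convex (growth_pairs alpha beta).
Proof.
move=> f0 g0 f1 g1 [/= f0ig g0ig [C0 C0gt0 le0]] [/= f1ig g1ig [C1 C1gt0 le1]].
move=> theta theta01; have /andP[theta0 theta1] := theta01.
split; [exact: inverse_interpolant_exists|exact: inverse_interpolant_exists|].
move=> f g [fig fE] [gig gE]; split=> //=.
exists (C0 `^ (1 - theta) * C1 `^ theta); first by rewrite mulr_gt0 ?powR_gt0.
move=> t t0; rewrite fE ?gE ?powR_ge0//.
by apply: wgeo_mean_le; rewrite ?le0 ?le1 ?subr_ge0 ?(ltW theta0) ?(ltW theta1)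
  ?(ltW C0gt0) ?(ltW C1gt0)//;
  apply: invertible_growth_ge0 (powR_ge0 _ _); apply: invertible_growth_ginv.
Qed.
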